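(* Let $f\ge 1$ be an integer, let $G=(V,E)$ be a connected graph with unique node identifiers, and let $S$ be the greedy $(2f+2,2f+1)$-ruling set of $G$. Suppose that every node $v$, except for at most $f$ faulty nodes, is given the label $\zeta(v)=b(v)\circ distS(v)$, where $b(v)=1$ if $v\in S$ and $b(v)=0$ otherwise, and $distS(v)=\min_{u\in S} dist(v,u)$; each faulty node is given an empty label. Then there exists a deterministic $\mathsf{Congest}$ algorithm at the end of which every node $v$ (faulty or not) outputs its correct value $b(v)$. The algorithm runs in $O(f)$ rounds.
   Context: $dist(u,v)$ denotes the hop distance in $G$. An $(\alpha,\beta)$-ruling set is a set $S\subseteq V$ such that every two distinct nodes of $S$ are at distance at least $\alpha$, and every node of $V$ is within distance at most $\beta$ of some node of $S$. The greedy $(2f+2,2f+1)$-ruling set is constructed by iterating over the nodes in increasing order of IDs: when a node $v$ that has not been excluded is reached, it is added to $S$, and all nodes within distance $2f+1$ of $v$ are excluded (and ignored in later iterations). In the $\mathsf{Congest}$ model, nodes communicate in synchronous rounds by exchanging $O(\log n)$-bit messages along edges, where $n=|V|$. $a\circ b$ denotes concatenation.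
   Formalization: The node identifiers are additionally assumed to be at most n^c for an arbitrary constant c (O(log n) bits, as is standard in Congest), with the message-size constant depending on c; with unbounded identifiers the claim fails, e.g. for two adjacent faulty nodes. *)

(* Defs.v *)
From mathcomp Require Import all_boot.

Set Implicit Arguments.
Unset Strict Implicit.
Unset Printing Implicit Defensive.

Definition simple_graph (V : finType) (e : rel V) : Prop :=
  symmetric e /\ irreflexive e.

Definition connected_graph (V : finType) (e : rel V) : Prop :=
  forall u v : V, connect e u v.

Definition walk_of_length (V : finType) (e : rel V) (k : nat) (u v : V) : bool :=
  [exists p : k.-tuple V, path e u p && (last u p == v)].

(* A shortest walk has fewer than #|V| edges; the value is #|V| when v is not
   reachable from u. *)
Definition dist (V : finType) (e : rel V) (u v : V) : nat :=
  find (fun k => walk_of_length e k u v) (iota 0 #|V|).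

(* The neutral value #|V| exceeds every distance between connected nodes, so it
   is only attained when S is empty or unreachable. *)
Definition dist_set (V : finType) (e : rel V) (S : {set V}) (v : V) : nat :=
  \big[minn/#|V|]_(u in S) dist e v u.

(* The pair holds the set built so far and the set of excluded nodes. *)
Definition greedy_step (V : finType) (e : rel V) (r : nat)
    (SX : {set V} * {set V}) (v : V) : {set V} * {set V} :=
  if v \in SX.2 then SX
  else (v |: SX.1, SX.2 :|: [set u | dist e v u <= r]).

(* The greedy (r + 1, r)-ruling set. *)
Definition greedy_ruling_set (V : finType) (e : rel V) (id : V -> nat)
    (r : nat) : {set V} :=
  (foldl (greedy_step e r) (set0, set0)
     (sort (fun u v => id u <= id v) (enum V))).1.

(* Binary representation, most significant bit first; 0 is [:: false]. *)
Definition binary (m : nat) : seq bool :=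
  rev (mkseq (fun i => odd (m %/ 2 ^ i)) (trunc_log 2 m).+1).

Definition zeta (V : finType) (e : rel V) (S : {set V}) (v : V) : seq bool :=
  [:: v \in S] ++ binary (dist_set e S v).

Definition faulty_label (V : finType) (e : rel V) (S F : {set V}) (v : V) :
    seq bool :=
  if v \in F then [::] else zeta e S v.

(* port v lists the neighbours of v in the order of the ports of v; nodes
   address their neighbours by port and do not know which neighbour is behind
   a port. *)
Definition port_numbering (V : finType) (e : rel V) (port : V -> seq V) : Prop :=
  forall v : V, uniq (port v) /\ (forall u : V, (u \in port v) = e v u).

(* A deterministic node program with output in bool. A node starts from its
   identifier, its degree and its label, and knows nothing else of the network.
   In each round it sends the bit string [alg_send s i] on port i (the empty
   string is silence) and updates its state from the list of messages received,
   given in port order. A node whose state has an output has halted. *)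
Record congest_algorithm := CongestAlgorithm {
  alg_state : Type;
  alg_init : nat -> nat -> seq bool -> alg_state;
  alg_send : alg_state -> nat -> seq bool;
  alg_recv : alg_state -> seq (seq bool) -> alg_state;
  alg_output : alg_state -> option bool
}.

Definition message (A : congest_algorithm) (s : alg_state A) (i : nat) :
    seq bool :=
  if alg_output s is Some _ then [::] else alg_send s i.

Definition round (A : congest_algorithm) (V : finType) (port : V -> seq V)
    (st : V -> alg_state A) (v : V) : alg_state A :=
  if alg_output (st v) is Some _ then st v
  else alg_recv (st v)
         [seq message (st u) (index v (port u)) | u <- port v].

Definition run (A : congest_algorithm) (V : finType) (id : V -> nat)
    (port : V -> seq V) (label : V -> seq bool) (t : nat) : V -> alg_state A :=
  iter t (round port) (fun v => alg_init A (id v) (size (port v)) (label v)).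

(* Main.v *)
Require Import Defs.
From mathcomp Require Import all_boot.
From mathcomp Require Import zify.

(** If [v] is in [S] then [dist_set S u <= dist v u] for all [u].  Call a
    faulty node [v] a candidate if this holds for every non-faulty [u] within
    distance [f].  If a candidate [v] has two members [s], [t] of [S] within
    distance [2f+1], then the first halves of shortest paths from [v] to [s] and
    to [t] are faulty: a non-faulty [u] in the first half towards [s] has a
    member of [S] at distance at most [dist v u < dist u s], which differs from
    [s] and is within distance [2f+1] of it.  As [dist s t >= 2f+2], the two
    halves together contain at least [f] nodes, none of them [s] or [t], so
    neither [s] nor [t] is faulty.

    Consequently a candidate close to a faulty [s] in [S] has no other member of
    [S] within distance [2f+1], hence was excluded by [s] and has a larger
    identifier.  So a faulty node is in [S] iff it is a candidate and, within
    distance [2f+1], there is neither a non-faulty member of [S] nor a candidate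
    with a smaller identifier.  Candidates are recognised in [f] rounds by
    flooding the maximum of [dist_set S u - dist v u], and the comparison takes
    [2f+1] rounds of flooding the minimum of the keys: [0] for non-faulty
    members of [S], [id + 1] for candidates. *)

Set Implicit Arguments.
Unset Strict Implicit.
Unset Printing Implicit Defensive.

(** * Distances *)

Lemma walk_of_lengthP (V : finType) (e : rel V) (k : nat) (u v : V) :
  reflect (exists p, [/\ path e u p, last u p = v & size p = k])
          (walk_of_length e k u v).
Proof.
apply: (iffP existsP) => [[p /andP[ep /eqP lp]]|[p [ep lp sp]]].
  by exists p; split; rewrite ?size_tuple.
have spk : size p == k by rewrite sp.
by exists (Tuple spk); rewrite /= ep lp eqxx.
Qed.

Lemma dist_le_path (V : finType) (e : rel V) (u : V) (p : seq V) :
  path e u p -> dist e u (last u p) <= size p.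
Proof.
move=> ep; rewrite leqNgt; apply/negP => lt_pd.
(* [find] never exceeds the length of its list, so [size p] is among the lengths tested before the
   answer. *)
have lt_pV : size p < #|V|.
  apply: leq_trans lt_pd _; rewrite -[X in _ <= X](size_iota 0 #|V|).
  exact: find_size.
have := before_find 0 lt_pd; rewrite nth_iota // add0n => /walk_of_lengthP.
by apply; exists p.
Qed.

Lemma dist_lt_card (V : finType) (e : rel V) (u v : V) :
  connected_graph e -> dist e u v < #|V|.
Proof.
move=> conn; case/connectP: (conn u v) => p ep ->.
case/shortenP: ep => p' ep' up' _.
apply: leq_ltn_trans (dist_le_path ep') _.
by rewrite -/(size (u :: p')) -(card_uniqP up') max_card.
Qed.

Lemma dist_path (V : finType) (e : rel V) (u v : V) :
  connected_graph e ->
  exists p, [/\ path e u p, last u p = v & size p = dist e u v].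
Proof.
move=> conn; have lt_dV := dist_lt_card u v conn.
have hd : has (fun k => walk_of_length e k u v) (iota 0 #|V|).
  by rewrite has_find size_iota.
by have /walk_of_lengthP := nth_find 0 hd; rewrite nth_iota.
Qed.

Lemma dist_self (V : finType) (e : rel V) (u : V) : dist e u u = 0.
Proof. by apply/eqP; rewrite -leqn0; apply: (@dist_le_path V e u [::]). Qed.

Lemma dist0_eq (V : finType) (e : rel V) (u v : V) :
  connected_graph e -> dist e u v = 0 -> u = v.
Proof. by move=> /(dist_path u v)[[|w p] [_ <- <-]]. Qed.

Lemma dist_triangle (V : finType) (e : rel V) (v u w : V) :
  connected_graph e -> dist e u w <= dist e u v + dist e v w.
Proof.
move=> conn; have [p [ep lp <-]] := dist_path u v conn.
have [q [eq lq <-]] := dist_path v w conn.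
rewrite -size_cat -lq -lp -last_cat; apply: dist_le_path.
by rewrite cat_path ep lp.
Qed.

Lemma dist_sym_le (V : finType) (e : rel V) (u v : V) :
  symmetric e -> connected_graph e -> dist e v u <= dist e u v.
Proof.
move=> sym_e conn; have [p [ep <- <-]] := dist_path u v conn.
have ep' : path e (last u p) (rev (belast u p)).
  by rewrite rev_path (eq_path (e' := e)) // => x y; rewrite sym_e.
have := dist_le_path ep'; rewrite size_rev size_belast.
by case: p {ep ep'} => [|w p] //=; rewrite rev_cons last_rcons.
Qed.

Lemma dist_sym (V : finType) (e : rel V) (u v : V) :
  symmetric e -> connected_graph e -> dist e u v = dist e v u.
Proof. by move=> sym_e conn; apply/eqP; rewrite eqn_leq !dist_sym_le. Qed.

Lemma dist_edge (V : finType) (e : rel V) (v w u : V) :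
  connected_graph e -> e v w -> dist e v u <= (dist e w u).+1.
Proof.
move=> conn evw; have [p [ep <- <-]] := dist_path w u conn.
by apply: (@dist_le_path V e v (w :: p)); rewrite /= evw.
Qed.

Lemma dist_step (V : finType) (e : rel V) (v u : V) :
  connected_graph e -> v != u ->
  exists2 w, e v w & dist e v u = (dist e w u).+1.
Proof.
move=> conn; have [[|w p] [ep <- sp]] := dist_path v u conn.
  by rewrite eqxx.
case/andP: ep => evw ep _; exists w => //; apply/eqP.
by rewrite eqn_leq dist_edge //= -sp ltnS dist_le_path.
Qed.

Lemma dist_point (V : finType) (e : rel V) (v s : V) (i : nat) :
  connected_graph e -> i <= dist e v s ->
  exists x, dist e v x = i /\ dist e x s = dist e v s - i.
Proof.
move=> conn; elim: i v => [|i IH] v ltid.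
  by exists v; rewrite dist_self subn0.
have [eqvs|neq_vs] := eqVneq v s; first by rewrite eqvs dist_self in ltid.
have [w evw dvs] := dist_step conn neq_vs.
have [|x [dwx dxs]] := IH w; first by rewrite dvs in ltid.
exists x; have := dist_triangle x v s conn; have := dist_edge x conn evw.
by lia.
Qed.

(** A choice for each [i] separately; points for different [i] need not lie on one common path. The
    default [v] does not occur when [i <= dist e v s]. *)
Definition shortest_path_point (V : finType) (e : rel V) (v s : V) (i : nat) :
    V :=
  odflt v [pick x | (dist e v x == i) && (dist e x s == dist e v s - i)].

Lemma shortest_path_pointP (V : finType) (e : rel V) (v s : V) (i : nat) :
  connected_graph e -> i <= dist e v s ->
  dist e v (shortest_path_point e v s i) = i /\
  dist e (shortest_path_point e v s i) s = dist e v s - i.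
Proof.
move=> conn le_id; rewrite /shortest_path_point.
case: pickP => [x /andP[/eqP ? /eqP ?] //|none].
have [x [dvx dxs]] := dist_point conn le_id.
by have := none x; rewrite dvx dxs !eqxx.
Qed.

Lemma bigminn_le (I : eqType) (r : seq I) (P : pred I) (F : I -> nat)
    (n : nat) (i : I) :
  i \in r -> P i -> \big[minn/n]_(j <- r | P j) F j <= F i.
Proof.
elim: r => // j r IH; rewrite in_cons big_cons => /predU1P[->|ir] Pi.
  by rewrite Pi geq_minl.
by case: ifP => _; rewrite ?geq_min IH ?orbT.
Qed.

Lemma dist_set_le (V : finType) (e : rel V) (S : {set V}) (v u : V) :
  u \in S -> dist_set e S v <= dist e v u.
Proof. by move=> uS; apply: bigminn_le; rewrite ?mem_index_enum. Qed.

Lemma dist_set_le_card (V : finType) (e : rel V) (S : {set V}) (v : V) :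
  dist_set e S v <= #|V|.
Proof.
rewrite /dist_set; apply: (big_ind (fun m => m <= #|V|)) => // [x y lex _|u _].
  by rewrite geq_min lex.
rewrite -[X in _ <= X](size_iota 0 #|V|); exact: find_size.
Qed.

Lemma dist_set_attained (V : finType) (e : rel V) (S : {set V}) (v s : V) :
  connected_graph e -> s \in S ->
  exists2 u, u \in S & dist e v u = dist_set e S v.
Proof.
move=> conn sS; have : dist_set e S v < #|V|.
  exact: leq_ltn_trans (dist_set_le e v sS) (dist_lt_card v s conn).
(* The premise [m < #|V|] makes the case of the neutral value vacuous. *)
rewrite /dist_set; apply: (big_ind (fun m => m < #|V| ->
  exists2 u, u \in S & dist e v u = m)) => [|x y IHx IHy|u uS _].
- by rewrite ltnn.
- by rewrite /minn; case: ifP.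
- by exists u.
Qed.

(** * The greedy ruling set *)

(** Loop invariant of the greedy construction, by induction on the processed prefix; sortedness
    makes every excluding node earlier in identifier. *)
Lemma greedy_foldlP (V : finType) (e : rel V) (id : V -> nat) (r : nat)
    (l : seq V) :
  symmetric e -> connected_graph e -> injective id ->
  sorted (fun u v => id u <= id v) l -> uniq l ->
  let SX := foldl (greedy_step e r) (set0, set0) l in
  [/\ {subset SX.1 <= l},
      forall u, (u \in SX.2) = [exists s in SX.1, dist e s u <= r],
      {in SX.1 &, forall s t, dist e s t <= r -> s = t}
    & forall v, v \in l -> v \notin SX.1 ->
        exists s, [/\ s \in SX.1, id s < id v & dist e s v <= r]].
Proof.
move=> sym_e conn inj_id; elim/last_ind: l => [|l x IH] /=.
  move=> _ _; split=> [s|u|s t|v] //; rewrite inE //.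
  by apply/esym/existsP => -[s]; rewrite inE.
have le_tr : transitive (fun u v => id u <= id v).
  by move=> a b c; apply: leq_trans.
rewrite (sorted_pairwise le_tr) pairwise_rcons rcons_uniq => /andP[/allP lex].
rewrite -(sorted_pairwise le_tr) => sl /andP[xl ul]; rewrite foldl_rcons.
move: (IH sl ul); case: (foldl _ _ l) => S X /= [Sl Xdef sep excl].
rewrite /greedy_step /=; case: ifPn => [xX|xX] /=; split=> //.
- by move=> s /Sl sl'; rewrite mem_rcons in_cons sl' orbT.
- move=> v; rewrite mem_rcons in_cons => /predU1P[->|]; last exact: excl.
  move=> _; move: xX; rewrite Xdef => /existsP[s /andP[sS dsx]].
  exists s; split=> //; rewrite ltn_neqAle lex ?Sl // andbT.
  by apply: contraNneq xl => /inj_id <-; apply: Sl.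
- move=> s; rewrite in_setU1 mem_rcons in_cons => /predU1P[->|/Sl ->].
    by rewrite eqxx.
  by rewrite orbT.
- move=> u; rewrite !inE Xdef; apply/orP/existsP.
    case=> [/existsP[s /andP[sS dsu]]|dxu].
      by exists s; rewrite !inE sS orbT.
    by exists x; rewrite !inE eqxx.
  case=> s; rewrite in_setU1 => /andP[/predU1P[->|sS] dsu]; [by right|left].
  by apply/existsP; exists s; rewrite sS.
- have far s : s \in S -> dist e s x <= r -> False.
    move=> sS dsx; case/negP: xX; rewrite Xdef; apply/existsP; exists s.
    by rewrite sS.
  move=> s t; rewrite !in_setU1 => /predU1P[->|sS] /predU1P[->|tS] //.
  + by rewrite dist_sym // => /(far _ tS).
  + by move/(far _ sS).
  + exact: sep.
- move=> v; rewrite mem_rcons in_cons in_setU1 negb_or.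
  case: eqP => //= _ /excl exclv /exclv[s [sS lts dsv]].
  by exists s; rewrite in_setU1 sS orbT.
Qed.

Section GreedyRulingSet.

Context (V : finType) (e : rel V) (id : V -> nat) (r : nat).
Hypotheses (sym_e : symmetric e) (conn : connected_graph e).
Hypothesis inj_id : injective id.

Let enumP :
  let l := sort (fun u v => id u <= id v) (enum V) in
  [/\ sorted (fun u v => id u <= id v) l, uniq l & forall v, v \in l].
Proof.
split; last by move=> v; rewrite mem_sort mem_enum.
  by apply: sort_sorted => u v; apply: leq_total.
by rewrite sort_uniq enum_uniq.
Qed.

Lemma greedy_ruling_set_separated :
  {in greedy_ruling_set e id r &, forall s t, dist e s t <= r -> s = t}.
Proof.
have [sl ul _] := enumP.
by have [_ _ sep _] := greedy_foldlP r sym_e conn inj_id sl ul.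
Qed.

Lemma greedy_ruling_set_excluded (v : V) :
  v \notin greedy_ruling_set e id r ->
  exists s, [/\ s \in greedy_ruling_set e id r, id s < id v & dist e s v <= r].
Proof.
have [sl ul inl] := enumP.
have [_ _ _ excl] := greedy_foldlP r sym_e conn inj_id sl ul.
exact: excl.
Qed.

End GreedyRulingSet.

(** * Two members of [S] close to a candidate *)

Section TwoCloseMembers.

Context (V : finType) (e : rel V) (S F : {set V}) (f : nat) (v : V).
Hypotheses (sym_e : symmetric e) (conn : connected_graph e).
Hypothesis sep : {in S &, forall s t, dist e s t <= 2 * f + 1 -> s = t}.
Hypothesis cand :
  forall u, u \notin F -> dist e v u <= f -> dist_set e S u <= dist e v u.

Lemma first_half_faulty (s : V) (i : nat) :
  s \in S -> dist e v s <= 2 * f + 1 -> 2 * i < dist e v s ->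
  shortest_path_point e v s i \in F.
Proof.
move=> sS dvs lti; apply: contraT.
have [|] := @shortest_path_pointP V e v s i conn; first by lia.
set x := shortest_path_point _ _ _ _ => dvx dxs xF.
(* From [2 * i < dist e v s <= 2 * f + 1] follows [i <= f], so [x] is in the range of [cand]. *)
have := cand xF; rewrite dvx => /(_ ltac:(lia)) dSx.
have [t tS dxt] := dist_set_attained x conn sS.
have tri := dist_triangle x t s conn; rewrite (dist_sym t x) // in tri.
(* Here [dist e t s <= i + (dist e v s - i) <= 2 * f + 1]; but then [dist e x s <= i], against
   [2 * i < dist e v s]. *)
have tEs : t = s by apply: sep => //; lia.
by rewrite tEs in dxt; lia.
Qed.

Lemma two_close_members (s t : V) :
  s \in S -> t \in S -> s != t -> s \in F ->
  dist e v s <= 2 * f + 1 -> dist e v t <= 2 * f + 1 -> f < #|F|.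
Proof.
move=> sS tS neq_st sF dvs dvt.
have far : 2 * f + 1 < dist e s t.
  by rewrite ltnNge; apply: contra neq_st => /(sep sS tS) ->.
have tri x : dist e s t <= dist e x s + dist e x t.
  by rewrite (dist_sym x s) // dist_triangle.
set ds := dist e v s in dvs *; set dt := dist e v t in dvt *.
have dst : 2 * f + 2 <= ds + dt by have := tri v; rewrite -/ds -/dt; lia.
(* A common point at distance [i] from [v] yields
   [2f + 2 <= dist s t <= ds + dt - 2i], that is [i < m]. *)
pose m := (ds + dt - (2 * f + 2)) %/ 2 + 1.
pose p := shortest_path_point e v s; pose q := shortest_path_point e v t.
(* [lp] is the whole first half towards [s]; [lq] drops the first [m] points, which might also be in
   [lp]. *)
pose lp := [seq p i | i <- iota 0 ((ds + 1) %/ 2)].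
pose lq := [seq q i | i <- iota m ((dt + 1) %/ 2 - m)].
have pP i : 2 * i < ds ->
    [/\ dist e v (p i) = i, dist e (p i) s = ds - i & p i \in F].
  move=> lti; have [|? ?] := @shortest_path_pointP V e v s i conn.
    by rewrite -/ds; lia.
  by split=> //; apply: first_half_faulty.
have qP i : 2 * i < dt ->
    [/\ dist e v (q i) = i, dist e (q i) t = dt - i & q i \in F].
  move=> lti; have [|? ?] := @shortest_path_pointP V e v t i conn.
    by rewrite -/dt; lia.
  by split=> //; apply: first_half_faulty.
have ul : uniq (s :: lp ++ lq).
  rewrite /= mem_cat negb_or cat_uniq; apply/and4P; split.
  (* [s] is not in [lp], whose points have positive distance to [s], nor in [lq], whose points are
     within [2 * f + 1] of [t]. *)
  - apply/andP; split; apply/mapP => -[i]; rewrite mem_iota => lti sE.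
      by have [|_] := pP i; [lia | rewrite -sE dist_self; lia].
    by have [|_] := qP i; [lia | rewrite -sE; lia].
  - rewrite map_inj_in_uniq ?iota_uniq // => i j; rewrite !mem_iota => lti ltj.
    move=> pE; have [|pi _ _] := pP i; first by lia.
    by have [|pj _ _] := pP j; [lia | rewrite -pi pE pj].
  - apply/hasPn => x /mapP[i]; rewrite mem_iota => lti ->{x}.
    apply/mapP => -[j]; rewrite mem_iota => ltj qE.
    have [|qi qt _] := qP i; first by lia.
    have [|pj ps _] := pP j; first by lia.
    have eqij : i = j by rewrite -qi qE pj.
    by have := tri (q i); rewrite qt qE ps /m -eqij in lti *; lia.
  - rewrite map_inj_in_uniq ?iota_uniq // => i j; rewrite !mem_iota => lti ltj.
    move=> qE; have [|qi _ _] := qP i; first by lia.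
    by have [|qj _ _] := qP j; [lia | rewrite -qi qE qj].
have lF : {subset s :: lp ++ lq <= enum F}.
  move=> x; rewrite mem_enum in_cons mem_cat => /orP[/eqP->|/orP[]] // /mapP[i].
    by rewrite mem_iota => lti ->; have [|] := pP i; first by lia.
  by rewrite mem_iota => lti ->; have [|] := qP i; first by lia.
have := uniq_leq_size ul lF; rewrite -cardE; apply: leq_trans.
(* The halves, rounded up, have at least [f + m] points in total, so [lp] and [lq] give [f]; the
   faulty [s] is one more. *)
by rewrite /= size_cat !size_map !size_iota /m; lia.
Qed.

End TwoCloseMembers.

(** * Binary encoding *)

Definition unbinary (s : seq bool) : nat :=
  foldl (fun n (b : bool) => b + n.*2) 0 s.

Lemma foldr_bits (m k : nat) :
  foldr (fun (b : bool) n => b + n.*2) 0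
        [seq odd (m %/ 2 ^ i) | i <- iota 0 k] = m %% 2 ^ k.
Proof.
elim: k m => [|k IH] m /=; first by rewrite modn1.
rewrite expn0 divn1 -[1]addn0 iotaDl -map_comp.
rewrite (eq_map (g := fun i => odd (m %/ 2 %/ 2 ^ i))); last first.
  by move=> i /=; rewrite expnD -divnMA.
rewrite IH expnS; have := ltn_pmod (m %/ 2) (expn_gt0 2 k : 0 < 2 ^ k).
have := divn_eq m 2; rewrite modn2 {1}(divn_eq (m %/ 2) (2 ^ k)).
set a := m %/ 2 %/ _; set b := _ %% _ => {2}-> ltb.
have -> : (a * 2 ^ k + b) * 2 + odd m = a * (2 * 2 ^ k) + (odd m + b.*2) by lia.
by rewrite modnMDl modn_small //; lia.
Qed.

Lemma binaryK : cancel binary unbinary.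
Proof.
move=> m; rewrite /unbinary /binary foldl_rev foldr_bits modn_small //.
exact: trunc_log_ltn.
Qed.

(** The exponent is a successor because [binary 0] still has one bit. *)
Lemma size_binary_le (m k : nat) : m < 2 ^ k.+1 -> size (binary m) <= k.+1.
Proof.
rewrite size_rev size_mkseq ltnS => ltm.
have [->|m_gt0] := posnP m; first by rewrite trunc_log0.
rewrite -ltnS -(ltn_exp2l _ _ (isT : 1 < 2)).
exact: leq_ltn_trans (trunc_logP _ m_gt0) ltm.
Qed.

(** * The algorithm *)

(** [None] stands for infinity. It is sent as silence, which is unambiguous since [binary] is never
    empty. *)
Definition omin (a b : option nat) : option nat :=
  match a, b with
  | Some m, Some n => Some (minn m n)
  | None, _ => b
  | _, None => a
  end.

Definition oleq (a : option nat) (q : nat) : bool :=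
  if a is Some m then m <= q else false.

Lemma oleq_min (a b : option nat) (q : nat) :
  oleq (omin a b) q = oleq a q || oleq b q.
Proof. by case: a b => [m|] [n|] //=; rewrite ?geq_min ?orbF. Qed.

Lemma oleq_foldr (a : option nat) (l : seq (option nat)) (q : nat) :
  oleq (foldr omin a l) q = oleq a q || has (fun b => oleq b q) l.
Proof. by elim: l => [|b l IH] /=; rewrite ?orbF // oleq_min IH orbCA. Qed.

Lemma ltn_foldr_maxn (a : nat) (l : seq nat) (q : nat) :
  (q < foldr maxn a l) = (q < a) || has (fun b => q < b) l.
Proof. by elim: l => [|b l IH] /=; rewrite ?orbF // leq_max IH orbCA. Qed.

Definition encode_key (a : option nat) : seq bool :=
  if a is Some m then binary m else [::].

Definition decode_key (s : seq bool) : option nat :=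
  if s is [::] then None else Some (unbinary s).

Lemma encode_keyK : cancel encode_key decode_key.
Proof.
case=> [m|] //=; rewrite -{2}(binaryK m) /decode_key.
have : size (binary m) != 0 by rewrite size_rev size_mkseq.
by case: (binary m).
Qed.

(* The empty label is that of a faulty node. *)
Definition own_key (lab : seq bool) (i x : nat) : option nat :=
  if lab is b :: _ then (if b then Some 0 else None)
  else if x == 0 then Some i.+1 else None.

(* At node [v], [excess] is the maximum, over the non-faulty [u] reached so far,
   of the truncated difference [dist_set S u - dist v u], and [heard] is the
   smallest key received so far. *)
Record node_state := NodeState {
  clock : nat;
  node_id : nat;
  node_label : seq bool;
  excess : nat;
  heard : option nat
}.

Definition node_key (s : node_state) : option nat :=
  omin (heard s) (own_key (node_label s) (node_id s) (excess s)).

Definition node_send (f : nat) (s : node_state) (i : nat) : seq bool :=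
  if clock s < f then binary (excess s) else encode_key (node_key s).

(** The predecessor in the first phase accounts for the edge just crossed. *)
Definition node_recv (f : nat) (s : node_state) (msgs : seq (seq bool)) :
    node_state :=
  let: NodeState t i lab x h := s in
  if t < f then
    NodeState t.+1 i lab (foldr maxn x [seq (unbinary m).-1 | m <- msgs]) h
  else NodeState t.+1 i lab x (foldr omin h [seq decode_key m | m <- msgs]).

(** The phases take [f] and [2 * f + 1] rounds. As candidate keys are shifted by one, [heard] is at
    most [node_id] for key [0] or a strictly smaller identifier; an echo of the own key is
    harmless. *)
Definition node_output (f : nat) (s : node_state) : option bool :=
  if clock s < 3 * f + 1 then None
  else Some (if node_label s is b :: _ then b
             else (excess s == 0) && ~~ oleq (heard s) (node_id s)).

Definition label_algorithm (f : nat) : congest_algorithm :=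
  CongestAlgorithm
    (fun i _ lab => NodeState 0 i lab (unbinary (behead lab)) None)
    (node_send f) (node_recv f) (node_output f).

(** * Closed form of an execution *)

Lemma runS (A : congest_algorithm) (V : finType) (id : V -> nat)
    (port : V -> seq V) (label : V -> seq bool) (t : nat) (v : V) :
  run A id port label t.+1 v = Defs.round port (run A id port label t) v.
Proof. by []. Qed.

Section Execution.

Context (V : finType) (e : rel V) (id : V -> nat) (port : V -> seq V).
Context (label : V -> seq bool) (f : nat).
Hypotheses (conn : connected_graph e) (ports : port_numbering e port).

Fixpoint flood_excess (t : nat) (v : V) : nat :=
  if t is t'.+1 then
    foldr maxn (flood_excess t' v) [seq (flood_excess t' u).-1 | u <- port v]
  else unbinary (behead (label v)).

Definition initial_key (v : V) : option nat :=
  own_key (label v) (id v) (flood_excess f v).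

Fixpoint flood_key (t : nat) (v : V) : option nat :=
  if t is t'.+1 then
    foldr omin (flood_key t' v)
      [seq omin (flood_key t' u) (initial_key u) | u <- port v]
  else None.

(** The maximum is described by its thresholds; crossing an edge raises the threshold by one. *)
Lemma flood_excessP (t q : nat) (v : V) :
  q < flood_excess t v <->
  exists u, dist e v u <= t /\ q + dist e v u < flood_excess 0 u.
Proof.
elim: t q v => [|t IH] q v.
  split=> [ltq|[u []]]; first by exists v; rewrite dist_self addn0.
  by rewrite leqn0 => /eqP dvu; rewrite dvu addn0 -(dist0_eq conn dvu).
rewrite [flood_excess t.+1 v]/= ltn_foldr_maxn has_map; split.
  case/orP=> [/IH[u [dvu ltq]]|/hasP[w]].
    by exists u; split=> //; apply: leqW.
  rewrite (ports v).2 => evw /= ltq.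
  have /IH[u [dwu ltu]] : q.+1 < flood_excess t w by lia.
  by exists u; have := dist_edge u conn evw; rewrite -/(flood_excess 0 u); lia.
case=> u [dvu ltq]; have [eqvu|neq_vu] := eqVneq v u.
  by apply/orP; left; apply/IH; exists u; rewrite eqvu dist_self in ltq *.
have [w evw dE] := dist_step conn neq_vu.
apply/orP; right; apply/hasP; exists w; first by rewrite (ports v).2.
have : q.+1 < flood_excess t w by apply/IH; exists u; lia.
by rewrite /=; lia.
Qed.

Lemma flood_keyP (t q : nat) (v : V) :
  oleq (omin (flood_key t v) (initial_key v)) q <->
  exists u, dist e v u <= t /\ oleq (initial_key u) q.
Proof.
elim: t v => [|t IH] v.
  split=> [leq|[u []]]; first by exists v; rewrite dist_self.
  by rewrite leqn0 => /eqP /(dist0_eq conn) ->.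
(* The own key is regrouped with the earlier value of [flood_key], to fit the induction
   hypothesis. *)
rewrite /= oleq_min oleq_foldr has_map orbAC -oleq_min; split.
  case/orP=> [/IH[u [dvu lequ]]|/hasP[w]].
    by exists u; split=> //; apply: leqW.
  rewrite (ports v).2 => evw /= /IH[u [dwu lequ]].
  by exists u; have := dist_edge u conn evw; split=> //; lia.
case=> u [dvu lequ]; have [eqvu|neq_vu] := eqVneq v u.
  by apply/orP; left; apply/IH; exists u; rewrite eqvu dist_self.
have [w evw dE] := dist_step conn neq_vu.
apply/orP; right; apply/hasP; exists w; first by rewrite (ports v).2.
by apply/IH; exists u; split=> //; lia.
Qed.

Lemma run_label_algorithm (t : nat) (v : V) :
  t <= 3 * f + 1 ->
  run (label_algorithm f) id port label t v =
  NodeState t (id v) (label v) (flood_excess (minn t f) v)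
            (flood_key (t - f) v).
Proof.
elim: t v => [|t IH] v ltt; first by rewrite min0n sub0n.
rewrite runS /Defs.round.
rewrite (IH v (ltnW ltt)) /= /node_output /= ltt.
have -> : [seq message (run (label_algorithm f) id port label t u)
              (index v (port u)) | u <- port v] =
          [seq if t < f then binary (flood_excess t u)
               else encode_key (omin (flood_key (t - f) u) (initial_key u))
          | u <- port v].
  apply: eq_map => u; rewrite (IH u (ltnW ltt)) /message /= /node_output /= ltt.
  by rewrite /node_send /node_key /=; case: ltnP.
case: ltnP => [ltf|lef]; congr NodeState.
- rewrite (minn_idPl ltf) /= -map_comp.
  by congr foldr; apply: eq_map => u /=; rewrite binaryK.
- by have [-> ->] : t - f = 0 /\ t.+1 - f = 0 by lia.
- by rewrite (minn_idPr (leqW lef)).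
- rewrite subSn //= -map_comp.
  by congr foldr; apply: eq_map => u /=; rewrite encode_keyK.
Qed.

Lemma run_label_algorithm_halted (t : nat) (v : V) :
  3 * f + 1 <= t ->
  run (label_algorithm f) id port label t v =
  run (label_algorithm f) id port label (3 * f + 1) v.
Proof.
elim: t => [|t IH]; first by lia.
rewrite leq_eqVlt => /predU1P[->//|]; rewrite ltnS => let'.
rewrite runS /Defs.round.
by rewrite IH // run_label_algorithm //= /node_output /= ltnn.
Qed.

(** Flooding creates no value above the initial ones: an excess is bounded by some label, a key by
    some [(id u).+1]. *)
Lemma size_message_label_algorithm (b : nat) (t : nat) (v : V) (i : nat) :
  (forall u, unbinary (behead (label u)) < 2 ^ b.+1) ->
  (forall u, (id u).+1 < 2 ^ b.+1) ->
  size (message (run (label_algorithm f) id port label t v) i) <= b.+1.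
Proof.
move=> ltlab ltid.
have [let'|ltt] := leqP (3 * f + 1) t.
  rewrite run_label_algorithm_halted // run_label_algorithm //.
  by rewrite /message /= /node_output /= ltnn.
rewrite (run_label_algorithm v (ltnW ltt)) /message /= /node_output /= ltt.
rewrite /node_send /node_key /=; case: ltnP => [ltf|lef].
  apply: size_binary_le; rewrite ltnNge; apply/negP => lex.
  have : (2 ^ b.+1).-1 < flood_excess t v.
    by rewrite prednK ?expn_gt0.
  by case/flood_excessP=> u [_ /=]; have := ltlab u; lia.
rewrite -/(initial_key v).
case E: (omin _ _) => [k|] //=; apply: size_binary_le.
have /flood_keyP[u [dvu lequ]] :
    oleq (omin (flood_key (t - f) v) (initial_key v)) k by rewrite E /=.
have : oleq (omin (flood_key (t - f) v) (initial_key v)) (id u).+1.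
  apply/flood_keyP; exists u; split=> //; move: lequ.
  rewrite /initial_key /own_key; case: (label u) => [|[] l] //.
  by case: ifP => //=.
by rewrite E /= => lek; apply: leq_ltn_trans lek (ltid u).
Qed.

End Execution.

Lemma leq_exp_up_log (n : nat) : n <= 2 ^ up_log 2 n.
Proof. by case: n => // n; apply: up_logP. Qed.

Theorem theorem4 :
  exists K : nat, forall c : nat, exists B : nat,
  forall f : nat, 1 <= f ->
  exists A : congest_algorithm,
  forall (V : finType) (e : rel V) (id : V -> nat) (port : V -> seq V)
    (F : {set V}),
    simple_graph e -> connected_graph e ->
    injective id -> (forall v : V, id v <= #|V| ^ c) ->
    port_numbering e port ->
    #|F| <= f ->
    let S := greedy_ruling_set e id (2 * f + 1) in
    let st := run A id port (faulty_label e S F) in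
    (forall (t : nat) (v : V) (i : nat), i < size (port v) ->
       size (message (st t v) i) <= B * up_log 2 #|V|) /\
    (forall v : V, alg_output (st (K * f) v) = Some (v \in S)).
Proof.
(* [3 * f + 1 <= 4 * f] as [f >= 1]; the extra [2] in [c + 2] leaves room for the shift of keys and
   for distances when [c = 0]. *)
exists 4 => c; exists (c + 2) => f f_gt0; exists (label_algorithm f).
move=> V e id port F [sym_e irr_e] conn inj_id id_le ports leFf S st.
have lab0 u : flood_excess port (faulty_label e S F) 0 u =
              if u \in F then 0 else dist_set e S u.
  by rewrite /= /faulty_label; case: ifP => //= _; apply: binaryK.
split=> [t v i lti|v].
  (* The port [i] leads to a second node, so the logarithm is positive. *)
  have V_gt1 : 1 < #|V|.
    have : nth v (port v) i \in port v by rewrite mem_nth.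
    rewrite (ports v).2 => evw; apply/card_gt1P; exists v, (nth v (port v) i).
    by split=> //; apply: contraTneq evw => <-; rewrite irr_e.
  have L_gt0 : 0 < up_log 2 #|V| by rewrite up_log_gt0.
  have ltV := leq_exp_up_log #|V|.
  set L := up_log 2 #|V| in L_gt0 ltV *.
  have -> : (c + 2) * L = ((c + 2) * L).-1.+1 by rewrite prednK; lia.
  apply: size_message_label_algorithm => // u.
    have := lab0 u; rewrite [LHS]/= => ->.
    apply: leq_ltn_trans (_ : 2 ^ L < _); last by rewrite ltn_exp2l //; nia.
    by case: ifP => // _; apply: leq_trans (dist_set_le_card e S u) ltV.
  rewrite prednK; last by lia.
  have : id u <= 2 ^ (c * L).
    apply: leq_trans (id_le u) _; rewrite [c * L]mulnC expnM.
    by case: (c) => // k; rewrite leq_exp2r.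
  have : 2 ^ (c * L) * 4 <= 2 ^ ((c + 2) * L).
    by rewrite -[4]/(2 ^ 2) -expnD leq_exp2l //; nia.
  by have := expn_gt0 2 (c * L); lia.
have sep := greedy_ruling_set_separated (r := 2 * f + 1) sym_e conn inj_id.
rewrite -/S in sep.
have excl u : u \notin S ->
    exists s, [/\ s \in S, id s < id u & dist e s u <= 2 * f + 1].
  exact: greedy_ruling_set_excluded.
pose lab := faulty_label e S F; pose X := flood_excess port lab f.
pose key := initial_key id port lab f.
(* Excess zero after [f] rounds characterises the candidates. *)
have X0P u : reflect (forall w, w \notin F -> dist e u w <= f ->
                        dist_set e S w <= dist e u w) (X u == 0).
  rewrite eqn0Ngt; apply: (iffP negP) => [X0 w wF duw|le_d].
    rewrite leqNgt; apply/negP => ltd; apply: X0.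
    by apply/(flood_excessP lab conn ports); exists w; rewrite lab0 (negPf wF).
  case/(flood_excessP lab conn ports) => w []; rewrite lab0 add0n.
  by case: ifPn => // wF /(le_d _ wF); lia.
have XS s : s \in S -> X s == 0.
  by move=> sS; apply/X0P => w _ _; rewrite (dist_sym s) ?dist_set_le.
have keyF u : u \in F -> key u = if X u == 0 then Some (id u).+1 else None.
  by move=> uF; rewrite /key /initial_key /lab /faulty_label uF.
have keyNF u : u \notin F -> key u = if u \in S then Some 0 else None.
  by move=> uF; rewrite /key /initial_key /lab /faulty_label (negPf uF).
rewrite /st run_label_algorithm_halted; last by lia.
rewrite run_label_algorithm // /= /node_output /= ltnn; congr Some.
have [-> ->] : minn (3 * f + 1) f = f /\ 3 * f + 1 - f = 2 * f + 1 by lia.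
rewrite -/X -/lab /lab {1}/faulty_label; case: ifPn => [vF|//]; rewrite -/lab.
have [Xv|Xv] := boolP (X v == 0); last first.
  by apply/esym/negbTE; apply: contra Xv; apply: XS.
set h := flood_key _ _ _ _ _ _.
(* The own key [(id v).+1] exceeds [id v], so adding it to [h] does not change the test. *)
have hP : oleq h (id v) <->
    exists u, dist e v u <= 2 * f + 1 /\ oleq (key u) (id v).
  rewrite -(flood_keyP id lab f conn ports) oleq_min -/key.
  by rewrite keyF // Xv /= ltnn orbF.
apply/idP/idP => [/negP hv|vS].
  (* The member [s] excluding [v] has key [0], or [(id s).+1 <= id v] if faulty. *)
  apply: contraT => /excl[s [sS lts dsv]]; case: hv; apply/hP; exists s.
  rewrite dist_sym //; split=> //; have [sF|sF] := boolP (s \in F).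
    by rewrite keyF // XS.
  by rewrite keyNF // sS.
apply/negP => /hP[u [dvu]]; have [uF|uF] := boolP (u \in F); last first.
  rewrite keyNF //; case: ifP => // uS _; move: uF.
  by rewrite -(sep _ _ vS uS dvu) vF.
rewrite keyF //; case: X0P => //= candu ltuv.
(* The candidate [u] was excluded by some [s] with [id s < id u < id v]; so [v] and [s] are two
   members close to [u], with [v] faulty, which needs more than [f] faults. *)
have [|s [sS lts dsu]] := excl u.
  by apply/negP => uS; rewrite (sep _ _ vS uS dvu) ltnn in ltuv.
have neq_vs : v != s by apply: contraTneq lts => <-; lia.
have := two_close_members sym_e conn sep candu vS sS neq_vs vF.
by rewrite !(dist_sym u) // => /(_ dvu dsu); lia.
Qed.
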